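(* Let $\kappa$ be an infinite cardinal, $I$ a set with $|I|\le\kappa$, $U$ an ultrafilter on $I$, and for each $i\in I$ let $U_i$ be a normal measure on $\kappa$ (so $B_i=\kappa$ for all $i$). Suppose there is $K\in U$ such that $U_i\neq U_j$ for all distinct $i,j\in K$. If $g$ is a function with domain $I\times\kappa$ which is not $U*\langle U_i\colon i\in I\rangle$-equivalent to any function in $\mathcal T$, then $g$ is $U*\langle U_i\colon i\in I\rangle$-equivalent to a one-to-one function.
   Context: Sum of ultrafilters: given a nonempty set $I$, nonempty sets $B_i$ ($i\in I$), an ultrafilter $U$ on $I$ and ultrafilters $U_i$ on $B_i$, let $\bigoplus_{i\in I}B_i=\{(i,x)\colon i\in I,\ x\in B_i\}$ and define $U*\langle U_i\colon i\in I\rangle$ as the family of $T\subseteq\bigoplus_{i\in I}B_i$ such that $\{i\in I\colon\{x\in B_i\colon(i,x)\in T\}\in U_i\}\in U$; this is an ultrafilter on $\bigoplus_{i\in I}B_i$ (here $I\times\kappa$). Two functions $f_1,f_2$ with domain $X$ are $W$-equivalent, for an ultrafilter $W$ on $X$, if $\{x\in X\colon f_1(x)=f_2(x)\}\in W$. $\mathcal T$ is the class of functions $f'$ on $\bigoplus_{i\in I}B_i$ of the form $f'(i,x)=f(i)$ for some function $f$ with domain $I$. *)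

(* Defs.v *)
From mathcomp Require Import all_boot all_order.
From mathcomp Require Import boolp classical_sets functions cardinality filter.
From mathcomp Require Import wochoice.

Set Implicit Arguments.
Unset Strict Implicit.
Unset Printing Implicit Defensive.

Local Open Scope classical_set_scope.
Local Open Scope card_scope.
Local Open Scope order_scope.

(* An infinite cardinal as an initial ordinal: the ordered type [kappa] is the
   set of ordinals below it, so [[set b | b < a]] is the ordinal [a], which must
   have strictly smaller cardinality. *)
Definition infinite_cardinal d (kappa : orderType d) : Prop :=
  [/\ well_order (<=%O : rel kappa),
      infinite_set [set: kappa] &
      forall a : kappa, ~ ([set: kappa] #<= [set b : kappa | b < a])].

(* Closure under intersections of fewer than [kappa] members. *)
Definition card_complete d (kappa : orderType d) (F : set_system kappa) : Prop :=
  forall A : set_system kappa,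
    A `<=` F -> ~ ([set: kappa] #<= A) -> F (\bigcap_(X in A) X).

Definition diag_intersection d (kappa : orderType d) (X : kappa -> set kappa) :
    set kappa :=
  [set b | forall a, a < b -> X a b].

Definition normal_measure d (kappa : orderType d) (F : set_system kappa) : Prop :=
  [/\ UltraFilter F,
      forall x : kappa, F <> principal_filter x,
      card_complete F &
      forall X : kappa -> set kappa,
        (forall a, F (X a)) -> F (diag_intersection X)].

Definition dsum (I : Type) (B : I -> Type) : Type := {i : I & B i}.

Definition ultra_sum (I : Type) (B : I -> Type) (U : set_system I)
    (V : forall i, set_system (B i)) : set_system (dsum B) :=
  [set S | U [set i | V i [set x | S (existT B i x)]]].

Definition uf_equivalent (X Y : Type) (W : set_system X) (f1 f2 : X -> Y) : Prop :=
  W [set x | f1 x = f2 x].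

(* The class T of functions depending only on the first coordinate. *)
Definition first_coord_funs (I : Type) (B : I -> Type) (Y : Type) :
    set (dsum B -> Y) :=
  [set f' | exists f : I -> Y, forall i (x : B i), f' (existT B i x) = f i].
Arguments first_coord_funs {I} B Y.

(* Main.v *)
(* Since no [g(i, .)] is constant on a set of [V i], normality of [V i] lets
   us find [A i] in [V i] such that [x] in [A i] implies [e i < x] (where [e]
   injects [I] in [kappa]) and [g(i, x) <> g(j, y)] for all [y < x] and all [j]
   with [e j < x].  As [V i <> V j], the [A i] can moreover be made pairwise
   disjoint by a second diagonal intersection, so [g] is one-to-one on the union
   of the [{i} * A i].  To correct [g] outside a large set without leaving its
   codomain, one removes from a single fibre [A i0] a [V i0]-null copy of
   [kappa * kappa], whose [g]-values are reused on the complement. *)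
Require Import Defs.
From mathcomp Require Import all_boot all_order.
From mathcomp Require Import boolp classical_sets functions cardinality filter.
From mathcomp Require Import wochoice.
From Stdlib Require Import Relation_Operators Wellfounded.

Set Implicit Arguments.
Unset Strict Implicit.

Import Order.TTheory.

Local Open Scope order_scope.
Local Open Scope classical_set_scope.
Local Open Scope card_scope.

(** * A well-founded order on pairs *)

Lemma well_order_wf (d : Order.disp_t) (T : orderType d) :
  well_order (<=%O : rel T) -> well_founded (fun a b : T => a < b).
Proof.
move=> wo a; apply: contrapT => Na.
have [|m [[mA mmin] _]] := wo [pred x | `[< ~ Acc (fun a b : T => a < b) x >]].
  by exists a; apply/asboolP.
move/asboolP: mA; apply; constructor => y ym; apply: contrapT => Ny.
have /mmin : y \in [pred x | `[< ~ Acc (fun a b : T => a < b) x >]].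
  exact/asboolP.
by rewrite leNgt ym.
Qed.

(* The order in which Goedel's pairing function enumerates pairs. *)
Definition pair_lt (d : Order.disp_t) (T : orderType d) (z w : T * T) : Prop :=
  let m (u : T * T) := (Order.max u.1 u.2, u) in
  slexprod T (T * T) (fun a b => a < b)
    (slexprod T T (fun a b => a < b) (fun a b => a < b)) (m z) (m w).

Lemma pair_lt_wf (d : Order.disp_t) (T : orderType d) :
  well_order (<=%O : rel T) -> well_founded (@pair_lt d T).
Proof.
move=> /well_order_wf wf.
exact: (wf_inverse_image _ _ _ _ (wf_slexprod _ _ _ _ wf
  (wf_slexprod _ _ _ _ wf wf))).
Qed.

(** This confines the predecessors of a pair to a square, so that the recursion in [normal_pairing]
    can go past all of them. *)
Lemma pair_lt_max (d : Order.disp_t) (T : orderType d) (z w : T * T) :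
  pair_lt z w -> Order.max z.1 z.2 <= Order.max w.1 w.2.
Proof.
rewrite /pair_lt /=; set x := Order.max _ _; set y := Order.max _ _ => h.
by inversion h => //; apply: ltW.
Qed.

Lemma pair_lt_total (d : Order.disp_t) (T : orderType d) (z w : T * T) :
  z <> w -> pair_lt z w \/ pair_lt w z.
Proof.
case: z w => [a b] [a' b'] zw; rewrite /pair_lt /=.
case: (ltgtP (Order.max a b) (Order.max a' b')) => [h|h|->].
- by left; apply: left_slex.
- by right; apply: left_slex.
case: (ltgtP a a') => [h|h|ea].
- by left; apply: right_slex; apply: left_slex.
- by right; apply: right_slex; apply: left_slex.
subst a'; case: (ltgtP b b') => [h|h|eb].
- by left; apply: right_slex; apply: right_slex.
- by right; apply: right_slex; apply: right_slex.
by subst b'.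
Qed.

(** * A single normal measure *)

Section NormalMeasure.
Variables (d : Order.disp_t) (kappa : orderType d).
Hypothesis hkappa : infinite_cardinal kappa.
Variable F : set_system kappa.
Hypothesis hF : normal_measure F.

Let FU : UltraFilter F. Proof. by case: hF. Qed.
Existing Instance FU.

Lemma ultrafilter_neq (Y : Type) (f : kappa -> Y) (v : Y) :
  ~ F [set x | f x = v] -> F [set x | f x <> v].
Proof.
by move=> nF; have [|] := in_ultra_setVsetC [set x | f x = v] FU.
Qed.

Lemma normal_setC1 (c : kappa) : F (~` [set c]).
Proof.
have [Fc|//] := in_ultra_setVsetC [set c] FU.
have [_ /(_ c) np _ _] := hF.
case: np; apply/seteqP; split => X; rewrite principal_filterP => h.
  by have [x [-> Xx]] := filter_ex (filterI Fc h).
by apply: filterS Fc => x ->.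
Qed.

(** As [kappa] is an initial ordinal, fewer than [kappa] points lie below [c], so completeness
    discards them all at once. *)
Lemma normal_gt (c : kappa) : F [set x | c < x].
Proof.
have [_ _ comp _] := hF.
have h : F (\bigcap_(X in (fun b => ~` [set b]) @` [set b | b < c]) X).
  apply: comp => [X [b _ <-]|le]; first exact: normal_setC1.
  have [_ _ /(_ c)] := hkappa; apply.
  exact: card_le_trans le (card_image_le _ _).
apply: filterS2 h (normal_setC1 c) => x h nc /=.
rewrite ltNge le_eqVlt; apply/negP => /orP[/eqP //|xc].
by apply: (h (~` [set x])); first by exists x.
Qed.

Lemma normal_diag (X : kappa -> set kappa) :
  (forall a, F (X a)) -> F [set x | forall a, a < x -> X a x].
Proof. by have [_ _ _] := hF; apply. Qed.

Lemma normal_diag_inj (J : Type) (e : J -> kappa) (X : J -> set kappa) :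
  injective e -> (forall j, F (X j)) ->
  F [set x | forall j, e j < x -> X j x].
Proof.
move=> einj FX.
(* The condition at [a] is [X j] for the unique [j] with image [a], and is vacuous if there is
   none. *)
have h : F [set x | forall a, a < x -> [set y | forall j, e j = a -> X j y] x].
  apply: normal_diag => a.
  have [[j ja]|nj] := pselect (exists j, e j = a).
    apply: filterS (FX j) => y Xy k ka; suff -> : k = j by [].
    by apply: einj; rewrite ka.
  by apply: filterS filterT => y _ j ja; case: nj; exists j.
by apply: filterS h => x h j jx; apply: h jx j erefl.
Qed.

(** Past [c], a point of the diagonal intersection satisfies every condition indexed up to [c]. *)
Lemma normal_le (X : kappa -> set kappa) (c : kappa) :
  (forall a, F (X a)) -> F [set x | forall a, a <= c -> X a x].
Proof.
move=> FX; apply: filterS2 (normal_gt c) (normal_diag FX) => x cx h a ac.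
exact/h/(le_lt_trans ac).
Qed.

(** Greedy recursion along [pair_lt]: each value is a point of [A] above all earlier ones, so
    totality of the order gives injectivity. *)
Lemma normal_pairing (A : set kappa) : F A ->
  exists2 p : kappa * kappa -> kappa, injective p & forall z, A (p z).
Proof.
move=> FA; have [wo _ _] := hkappa.
have [x0 _] := filter_ex FA.
have wf := pair_lt_wf wo.
pose P (z : kappa * kappa) (r : forall w, pair_lt w z -> kappa) :=
  [set x | A x /\ forall w (h : pair_lt w z), r w h < x].
pose p := Fix wf (fun=> kappa) (fun z r => xget x0 (P z r)).
have pE z : p z = xget x0 (P z (fun w _ => p w)).
  rewrite /p Fix_eq // => u r s rs; congr xget.
  apply/seteqP; split => x [Ax h]; split => // w k; first by rewrite -rs.
  by rewrite rs.
have pP z : P z (fun w _ => p w) (p z).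
  rewrite [p z]pE; apply: xgetPex.
  pose c := Order.max z.1 z.2.
  (* One bound for each coordinate: large-many points exceed [p] on the whole square up to [c]. *)
  have Fc : F [set x | forall a, a <= c ->
      [set y | forall b, b <= c -> [set t | p (a, b) < t] y] x].
    by apply: normal_le => a; apply: normal_le => b; apply: normal_gt.
  have [x [Ax hx]] := filter_ex (filterI FA Fc).
  exists x; split => // -[a b] /pair_lt_max; rewrite -/c /= ge_max.
  by move=> /andP[ac bc]; apply: hx.
exists p => [z w zw|z]; last by case: (pP z).
apply: contrapT => /pair_lt_total[]h.
  by have [_ /(_ _ h)] := pP w; rewrite zw ltxx.
by have [_ /(_ _ h)] := pP z; rewrite zw ltxx.
Qed.

(* Composing a pairing with itself yields two injections with disjoint ranges,
   of which at most one is of measure one. *)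
Lemma normal_null_pairing (A : set kappa) : F A ->
  exists p : kappa * kappa -> kappa,
    [/\ injective p, forall z, A (p z) & F (~` range p)].
Proof.
move=> FA; have [q qinj qA] := normal_pairing FA.
have [c0 _] := filter_ex FA.
have [c1 /= c01] := filter_ex (normal_gt c0).
pose r c z := q (q z, c).
have rinj c : injective (r c) by move=> z w /qinj[/qinj].
have [Fr|Fr] := in_ultra_setVsetC (range (r c0)) FU; last first.
  by exists (r c0); split => // z; apply: qA.
exists (r c1); split => //; first by move=> z; apply: qA.
apply: filterS Fr => _ [z _ <-] [w _ /qinj[_ c10]].
by move: c01; rewrite c10 ltxx.
Qed.

End NormalMeasure.

(** * Families of ultrafilters *)

Lemma ultrafilter_separation (T : Type) (F G : set_system T) :
  UltraFilter F -> UltraFilter G -> F <> G ->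
  exists2 X : set T, F X & G (~` X).
Proof.
move=> FU GU FG; apply: contrapT => h; apply: FG; apply/seteqP; split=> X hX.
  have [//|GX] := in_ultra_setVsetC X GU.
  by case: h; exists X.
have [//|FX] := in_ultra_setVsetC X FU.
by case: h; exists (~` X) => //; rewrite setCK.
Qed.

Lemma card_le_setT_inj (S T : Type) :
  [set: S] #<= [set: T] -> exists f : S -> T, injective f.
Proof.
move=> /card_leP/unsquash f.
exists (fun s => \val (f (to_setT s))) => s t st.
have /(f_equal (fun u => \val u)) //: to_setT s = to_setT t.
by apply: (inj (f := f)); rewrite ?inE //; apply: val_inj.
Qed.

(** If [x] lies in both [A i] and [A j], then [e i] and [e j] are below [x], so each diagonal
    intersection sees the other index: one puts [x] in the separating set [X (i, j)], the other
    outside it. *)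
Lemma pairwise_disjoint_normal (d : Order.disp_t) (kappa : orderType d)
    (hkappa : infinite_cardinal kappa) (I : Type) (e : I -> kappa)
    (V : I -> set_system kappa) (K : set I) :
  injective e -> (forall i, normal_measure (V i)) ->
  (forall i j, K i -> K j -> i <> j -> V i <> V j) ->
  exists2 A : I -> set kappa, (forall i, V i (A i)) &
    forall i j x, K i -> K j -> A i x -> A j x -> i = j.
Proof.
move=> einj hV hK.
have VU i : UltraFilter (V i) by case: (hV i).
have /choice[X hX] : forall ij : I * I, exists X : set kappa,
    K ij.1 -> K ij.2 -> ij.1 <> ij.2 -> V ij.1 X /\ V ij.2 (~` X).
  move=> [i j] /=; have [[Ki [Kj ij]]|h] := pselect (K i /\ K j /\ i <> j).
    have [X ? ?] := ultrafilter_separation (VU i) (VU j) (hK i j Ki Kj ij).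
    by exists X.
  by exists setT => Ki Kj ij; case: h.
exists (fun i => [set x | e i < x /\ forall j, e j < x ->
    [set y | K i -> K j -> i <> j -> X (i, j) y /\ ~ X (j, i) y] x]) => [i|].
  apply: filterI; first exact: normal_gt.
  apply: (normal_diag_inj (hV i) einj) => j.
  have [[Ki [Kj ij]]|h] := pselect (K i /\ K j /\ i <> j).
    have [Xij _] := hX (i, j) Ki Kj ij.
    have [_ Xji] := hX (j, i) Kj Ki (fun ji => ij (esym ji)).
    by apply: filterS2 Xij Xji => y.
  by apply: filterS filterT => y _ Ki Kj ij; case: h.
move=> i j x Ki Kj [eix Aix] [ejx Ajx]; apply: contrapT => ij.
have [Xij _] := Aix j ejx Ki Kj ij.
by have [_] := Ajx i eix Kj Ki (fun ji => ij (esym ji)).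
Qed.

(* Nothing separates the fibres over a common [x] here: that is the job of
   [pairwise_disjoint_normal]. *)
Lemma off_diagonal_injective_normal (d : Order.disp_t) (kappa : orderType d)
    (hkappa : infinite_cardinal kappa) (I : Type) (e : I -> kappa)
    (V : I -> set_system kappa) (Y : Type) (g : I -> kappa -> Y) (N : set I) :
  injective e -> (forall i, normal_measure (V i)) ->
  (forall i v, N i -> ~ V i [set x | g i x = v]) ->
  exists2 A : I -> set kappa, (forall i, V i (A i)) &
    forall i j x y, N i -> N j -> A i x -> A j y -> g i x = g j y -> x = y.
Proof.
move=> einj hV hN.
have VU i : UltraFilter (V i) by case: (hV i).
exists (fun i => [set x | e i < x /\ forall b, b < x -> [set y |
    forall j, e j < y -> [set z | N i -> g i z <> g j b] y] x]) => [i|].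
  apply: filterI; first exact: normal_gt.
  apply: (normal_diag (hV i)) => b.
  apply: (normal_diag_inj (hV i) einj) => j.
  have [Ni|Ni] := pselect (N i); last by apply: filterS filterT => y _ /Ni.
  by apply: filterS (ultrafilter_neq (hV i) (hN i (g j b) Ni)) => y gy _.
(* The larger point avoids the values at the smaller one: [e j < y < x] makes [j] visible at [x]. *)
have lt_neq i j x y : N i -> e j < y -> y < x ->
    (forall b, b < x -> forall j, e j < x -> N i -> g i x <> g j b) ->
    g i x <> g j y.
  by move=> Ni ejy yx h; apply: h => //; apply: lt_trans yx.
move=> i j x y Ni Nj [eix Aix] [ejy Ajy] gxy.
case: (ltgtP x y) => // xy.
  by case: (lt_neq j i y x Nj eix xy Ajy).
by case: (lt_neq i j x y Ni ejy xy Aix).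
Qed.

Theorem theorem2p9 (d : Order.disp_t) (kappa : orderType d)
    (hkappa : infinite_cardinal kappa)
    (I : Type) (hI : [set: I] #<= [set: kappa])
    (U : set_system I) (hU : UltraFilter U)
    (V : I -> set_system kappa) (hV : forall i, normal_measure (V i))
    (hK : exists2 K : set I, U K &
            forall i j, K i -> K j -> i <> j -> V i <> V j)
    (Y : Type) (g : dsum (fun _ : I => kappa) -> Y)
    (hg : forall f', first_coord_funs (fun _ : I => kappa) Y f' ->
            ~ uf_equivalent (ultra_sum U V) g f') :
  exists2 h : dsum (fun _ : I => kappa) -> Y,
    injective h & uf_equivalent (ultra_sum U V) g h.
Proof.
have [K UK VK] := hK; have [e einj] := card_le_setT_inj hI.
have VU i : UltraFilter (V i) by case: (hV i).
have x0 : inhabited kappa.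
  have [i _] := filter_ex UK; have [x _] := filter_ex (@filterT _ (V i) _).
  exact: inhabits x.
have {x0} [x0] := x0.
pose gi i x := g (existT (fun=> kappa) i x).
pose N := [set i | forall v, ~ V i [set x | gi i x = v]].
(* Otherwise the almost constant values of [gi i] define a function of the first coordinate
   equivalent to [g]. *)
have UN : U N.
  have [//|UC] := in_ultra_setVsetC N hU; exfalso.
  have /choice[f hf] : forall i, exists v, ~ N i -> V i [set x | gi i x = v].
    move=> i; have [Ni|/existsNP[v /contrapT Vv]] := pselect (N i).
      by exists (gi i x0).
    by exists v.
  apply: (hg (fun z => f (projT1 z))); first by exists f.
  by apply: filterS UC => i /hf.
have [A VA Adisj] := pairwise_disjoint_normal hkappa einj hV VK.
have [B VB Binj] := off_diagonal_injective_normal hkappa einj hV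
  (fun i v (Ni : N i) => Ni v).
have [i0 [Ki0 Ni0]] := filter_ex (filterI UK UN).
have [p [pinj pAB pF]] :=
  normal_null_pairing hkappa (hV i0) (filterI (VA i0) (VB i0)).
pose D := dsum (fun _ : I => kappa).
pose S (z : D) :=
  let: existT i x := z in [/\ K i, N i, A i x & B i x].
have ginj z w : S z -> S w -> g z = g w -> z = w.
  case: z w => [i x] [j y] [Ki Ni Ax Bx] [Kj Nj Ay By] gxy.
  have xy := Binj _ _ _ _ Ni Nj Bx By gxy; subst y.
  by have -> : i = j := Adisj _ _ _ Ki Kj Ax Ay.
(* Coding the index by [e] embeds all of [D] in a null part of the fibre over [i0], still inside
   [S]. *)
pose q (z : D) : D := existT _ i0 (p (e (projT1 z), projT2 z)).
have qS z : S (q z) by have [] := pAB (e (projT1 z), projT2 z).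
have qinj : injective q.
  move=> [i x] [j y].
  by move=> /(f_equal (fun z : D => projT2 z)) /= /pinj[/einj -> ->].
pose T := S `\` range q.
(* Points of [T] keep their value and the others borrow one from [range q], which [T] avoids; [g] is
   injective on [S], which contains both. *)
exists (fun z : D => if pselect (T z) then g z else g (q z)) => [z w|].
  case: pselect => [[Sz nz]|nz]; case: pselect => [[Sw nw]|nw].
  - exact: ginj.
  - by move=> /(ginj _ _ Sz (qS w)) zw; case: nz; exists w.
  - by move=> /(ginj _ _ (qS z) Sw) zw; case: nw; exists z.
  - by move=> /(ginj _ _ (qS z) (qS w)) /qinj.
apply: filterS2 UK UN => i Ki Ni /=.
(* Only the fibre over [i0] loses points to [range q], and there the loss is null by [pF]. *)
have [ii0|ii0] := pselect (i = i0).
  subst i0; apply: filterS3 (VA i) (VB i) pF => x Ax Bx px /=.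
  case: pselect => // -[]; split => // -[z _].
  move=> /(f_equal (fun z : D => projT2 z)) /= zx.
  by apply: px; exists (e (projT1 z), projT2 z).
apply: filterS2 (VA i) (VB i) => x Ax Bx /=.
case: pselect => // -[]; split => // -[z _].
by move=> /(f_equal (fun z : D => projT1 z)) /= /esym.
Qed.
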